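(* Let $G$ be a graph whose independence number is $c(G)=2$, and let $I=J(G)$ be its cover ideal. Then $I$ is quasi-equigenerated.
   Context: All graphs are finite and simple. The independence number $c(G)$ is the maximal cardinality of a set of pairwise non-adjacent vertices of $G$. For a graph $G$ with vertices $x_1,\dots,x_n$ (identified with the variables of $R=k[x_1,\dots,x_n]$, $k$ a field) and edge set $E$, the cover ideal is $J(G)=\bigcap_{\{x_i,x_j\}\in E}(x_i,x_j)\subseteq R$. A monomial ideal $I$ of $R$ with minimal monomial generators $f_1,\dots,f_t$, $f_j=\prod_{i=1}^n x_i^{c_{ij}}$, is quasi-equigenerated if there is $\alpha=(a_1,\dots,a_n)$ with all $a_i$ positive integers such that $d_\alpha(f_j):=\sum_{i=1}^n a_i c_{ij}$ is the same for all $j$. *)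

(* Defs.v *)
From mathcomp Require Import all_boot all_algebra mpoly.
Set Implicit Arguments.
Unset Strict Implicit.
Unset Printing Implicit Defensive.
Import GRing.Theory.
Local Open Scope ring_scope.

(* Graphs on a finite vertex type [T] are symmetric irreflexive relations. *)

Definition independent (T : finType) (e : rel T) (A : {set T}) : bool :=
  [forall x in A, forall y in A, ~~ e x y].

Definition independence_number (T : finType) (e : rel T) : nat :=
  \max_(A : {set T} | independent e A) #|A|.

(* Ideals are Prop-valued predicates: MathComp's [idealr] structure only covers
   decidable proper ideals, and the cover ideal of an edgeless graph is the
   whole ring. *)

Definition gen_ideal (A : comNzRingType) (s : seq A) : A -> Prop :=
  fun p => exists c : 'I_(size s) -> A, p = \sum_(i < size s) c i * s`_i.

Definition cover_ideal (k : fieldType) (n : nat) (e : rel 'I_n) :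
    {mpoly k[n]} -> Prop :=
  fun p => forall i j : 'I_n, e i j -> gen_ideal [:: 'X_i; 'X_j] p.

Arguments cover_ideal k {n} e p.

Definition monomial_gens (k : fieldType) (n : nat) (I : {mpoly k[n]} -> Prop)
    (s : seq 'X_{1..n}) : Prop :=
  forall p : {mpoly k[n]}, I p <-> gen_ideal [seq 'X_[m] | m <- s] p.

(* Taking [t] to drop a repeated entry shows that such an [s] is [uniq]. *)
Definition minimal_monomial_gens (k : fieldType) (n : nat)
    (I : {mpoly k[n]} -> Prop) (s : seq 'X_{1..n}) : Prop :=
  monomial_gens I s /\
  forall t : seq 'X_{1..n}, subseq t s -> monomial_gens I t -> t = s.

Definition wdeg (n : nat) (a : 'I_n -> nat) (m : 'X_{1..n}) : nat :=
  (\sum_(i < n) a i * m i)%N.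

(* The minimal monomial generating set of a monomial ideal is unique up to
   order, so asserting the existence of [s] says that [I] is a monomial ideal
   and refers to its minimal monomial generators. *)
Definition quasi_equigenerated (k : fieldType) (n : nat)
    (I : {mpoly k[n]} -> Prop) : Prop :=
  exists s : seq 'X_{1..n}, minimal_monomial_gens I s /\
  exists a : 'I_n -> nat, (forall i, 0 < a i)%N /\
  forall m1 m2, m1 \in s -> m2 \in s -> wdeg a m1 = wdeg a m2.

(* Main.v *)
Require Import Defs.
(* [mpoly] comes first because it shadows [symmetric]. *)
From mathcomp Require Import mpoly all_boot all_algebra.
Set Implicit Arguments.
Unset Strict Implicit.
Unset Printing Implicit Defensive.
Import GRing.Theory.

(* The minimal generators of [J(G)] are the monomials of the complements of the
   maximal independent sets of [G].  Since [c(G) = 2], such a set is either a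
   pair of non-adjacent vertices or a single vertex adjacent to all others.
   Giving weight 2 to the vertices of the second kind and 1 to the others makes
   every maximal independent set weigh 2, so all generators have the same
   weighted degree. *)

Section MonomialIdeals.
Local Open Scope ring_scope.

Lemma gen_ideal_mem (A : comNzRingType) (s : seq A) (x c : A) :
  x \in s -> gen_ideal s (c * x).
Proof.
move=> xs; have ix : (index x s < size s)%N by rewrite index_mem.
(* The coefficient [c] sits at the first occurrence of [x] in [s]; every other coefficient is 0. *)
exists (fun i => if i == Ordinal ix then c else 0).
rewrite (bigD1 (Ordinal ix)) //= eqxx nth_index // big1 ?addr0 // => i /negPf->.
by rewrite mul0r.
Qed.

Lemma gen_ideal_sum (A : comNzRingType) (s : seq A) (J : eqType) (r : seq J)
    (F : J -> A) :
  (forall j, j \in r -> gen_ideal s (F j)) -> gen_ideal s (\sum_(j <- r) F j).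
Proof.
move=> Fs; rewrite big_seq; elim/big_ind: _ => [|x y [c ->] [d ->]|//].
  by exists (fun=> 0); rewrite big1 // => i _; rewrite mul0r.
exists (fun i => c i + d i); rewrite -big_split; apply: eq_bigr => i _.
by rewrite mulrDl.
Qed.

(** Membership is tested monomial by monomial: each monomial of a multiple of ['X_[m']] is divisible
    by [m'], and conversely a polynomial is the sum of its terms. *)
Lemma gen_ideal_monomialsP (k : fieldType) (n : nat) (s : seq 'X_{1..n})
    (p : {mpoly k[n]}) :
  gen_ideal [seq 'X_[m] | m <- s] p <->
  forall m, m \in msupp p -> exists2 m', m' \in s & (m' <= m)%MM.
Proof.
split=> [[c ->] m /msupp_sum_le /flatten_mapP [i _]|sp].
  have lt_i : (i < size s)%N by rewrite -(size_map (fun m => 'X_[k, m]) s).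
  rewrite (nth_map 0%MM) // (perm_mem (msuppMX _ _)) => /mapP [m' _ ->].
  by exists (nth 0%MM s i); [rewrite mem_nth|rewrite lem_addr].
rewrite [p]mpolyE; apply: gen_ideal_sum => m /sp [m' m's le_m'm].
rewrite -(submK le_m'm) mpolyXD scalerAl.
by apply: gen_ideal_mem; apply: map_f.
Qed.

Lemma minimal_monomial_gens_antichain (k : fieldType) (n : nat)
    (I : {mpoly k[n]} -> Prop) (s : seq 'X_{1..n}) :
    uniq s -> {in s &, forall m m', (m <= m')%MM -> m = m'} ->
  monomial_gens I s -> minimal_monomial_gens I s.
Proof.
move=> s_uniq s_anti sI; split=> // t ts tI.
(* A subsequence of the same size is the whole sequence, and [s] is duplicate-free, so it suffices
   that every element of [s] lies in [t]. Each such element is divisible by one of [t], hence equal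
   to it. *)
apply/eqP; rewrite -(size_subseq_leqif ts) eqn_leq size_subseq //=.
apply: uniq_leq_size => // m ms.
have /tI /gen_ideal_monomialsP /(_ m) : I 'X_[m].
  by apply/sI; rewrite -['X_[m]]mul1r; apply: gen_ideal_mem; apply: map_f.
rewrite msuppX mem_seq1 eqxx => /(_ isT) [m' m't /s_anti <- //].
exact: (mem_subseq ts).
Qed.

End MonomialIdeals.

Lemma independentP (T : finType) (e : rel T) (A : {set T}) :
  reflect {in A &, forall x y, ~~ e x y} (independent e A).
Proof.
apply: (iffP forall_inP) => [eA x y xA yA|eA x xA].
  by have /forall_inP := eA x xA; apply.
by apply/forall_inP => y yA; apply: eA.
Qed.

Definition set_mnm (n : nat) (C : {set 'I_n}) : 'X_{1..n} :=
  [multinom nat_of_bool (i \in C) | i < n].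

Lemma set_mnm_le (n : nat) (C : {set 'I_n}) (m : 'X_{1..n}) :
  (set_mnm C <= m)%MM = (C \subset [set i | 0 < m i]).
Proof.
apply/mnm_lepP/subsetP => Cm i.
  by move=> iC; have := Cm i; rewrite mnmE iC inE.
by rewrite mnmE; case: (boolP (i \in C)) => // /Cm; rewrite inE.
Qed.

Lemma set_mnm_supp (n : nat) (C : {set 'I_n}) : [set i | 0 < set_mnm C i] = C.
Proof. by apply/setP => i; rewrite inE mnmE; case: (i \in C). Qed.

(** Phrased through the complement, so that minimal covers correspond directly to maximal
    independent sets. *)
Definition vertex_cover (T : finType) (e : rel T) (C : {set T}) : bool :=
  independent e (~: C).

Lemma vertex_coverP (T : finType) (e : rel T) (C : {set T}) :
  reflect (forall x y, e x y -> (x \in C) || (y \in C)) (vertex_cover e C).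
Proof.
apply: (iffP (independentP _ _)) => eC x y.
  move=> exy; apply/negPn; rewrite negb_or; apply/negP => /andP [xC yC].
  by have := eC x y; rewrite !inE exy => /(_ xC yC).
by rewrite !inE => xC yC; apply/negP => /eC; rewrite (negPf xC) (negPf yC).
Qed.

(** Each edge ideal is monomial, and a monomial lies in it exactly when one of the two endpoints is
    in its support. *)
Lemma cover_idealP (k : fieldType) (n : nat) (e : rel 'I_n) (p : {mpoly k[n]}) :
  cover_ideal k e p <->
  forall m, m \in msupp p -> vertex_cover e [set i | 0 < m i].
Proof.
split=> [pJ m mp|pe i j eij].
  apply/vertex_coverP => i j /pJ.
  move=> /(gen_ideal_monomialsP [:: U_(i); U_(j)]%MM p) /(_ m mp) [m' + le_m'm].
  by rewrite !inE => /pred2P[] m'E; move: le_m'm;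
    rewrite m'E lep1mP -lt0n => ->; rewrite ?orbT.
apply/(gen_ideal_monomialsP [:: U_(i); U_(j)]%MM p) => m /pe.
move=> /vertex_coverP /(_ i j eij); rewrite !inE.
by case/orP => mi; [exists U_(i)%MM|exists U_(j)%MM];
  rewrite ?inE ?eqxx ?orbT ?lep1mP -?lt0n.
Qed.

Definition min_covers (T : finType) (e : rel T) : seq {set T} :=
  [seq C <- enum {: {set T}} | minset (vertex_cover e) C].

Lemma mem_min_covers (T : finType) (e : rel T) (C : {set T}) :
  (C \in min_covers e) = minset (vertex_cover e) C.
Proof. by rewrite mem_filter mem_enum andbT. Qed.

(** Every cover contains a minimal one, so the minimal covers generate; no minimal cover contains
    another, so their monomials form an antichain for divisibility. *)
Lemma cover_ideal_minimal_gens (k : fieldType) (n : nat) (e : rel 'I_n) :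
  minimal_monomial_gens (cover_ideal k e) [seq set_mnm C | C <- min_covers e].
Proof.
apply: minimal_monomial_gens_antichain.
- rewrite map_inj_uniq; first exact/filter_uniq/enum_uniq.
  move=> C D eqCD.
  by rewrite -(set_mnm_supp C) eqCD set_mnm_supp.
- move=> _ _ /mapP [C C_min ->] /mapP [D + ->].
  move: C_min; rewrite !mem_min_covers set_mnm_le set_mnm_supp.
  by case/minsetP => C_cov _ /minsetP [_ D_min] /D_min ->.
move=> p; split.
  move/cover_idealP => pe; apply/gen_ideal_monomialsP => m /pe.
  case/minset_exists => C C_min Cm; exists (set_mnm C).
    by apply: map_f; rewrite mem_min_covers.
  by rewrite set_mnm_le.
move/gen_ideal_monomialsP => sp; apply/cover_idealP => m /sp [_ /mapP [C + ->]].
rewrite mem_min_covers set_mnm_le => /minsetP [/vertex_coverP eC _] /subsetP Cm.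
by apply/vertex_coverP => i j /eC /orP [] /Cm ->; rewrite ?orbT.
Qed.

Definition nonneighbour_weight (T : finType) (e : rel T) (x : T) : nat :=
  if [exists y, (y != x) && ~~ e x y] then 1 else 2.

Lemma independent_card (T : finType) (e : rel T) (A : {set T}) :
  independent e A -> #|A| <= independence_number e.
Proof. by move=> eA; apply: (bigmax_sup A). Qed.

Lemma max_independent_weight (T : finType) (e : rel T) (A : {set T}) :
    symmetric e -> irreflexive e -> independence_number e = 2 ->
    independent e A -> (forall B, independent e B -> A \subset B -> B = A) ->
  \sum_(x in A) nonneighbour_weight e x = 2.
Proof.
move=> e_sym e_irr e2 eA A_max.
have := independent_card eA; rewrite e2.
case cardA : #|A| => [|[|[|]]] // _.
(* If the empty set were maximal, there would be no vertex at all, since singletons are independent;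
   the independence number would then be 0. *)
- move/eqP: cardA; rewrite cards_eq0 => /eqP A0.
  have T0 (x : T) : false.
    have /A_max : independent e [set x].
      by apply/independentP => y z /set1P-> /set1P->; rewrite e_irr.
    by rewrite A0 sub0set => /(_ isT) /setP /(_ x); rewrite !inE eqxx.
  suff : independence_number e <= 0 by rewrite e2.
  apply/bigmax_leqP => B _; rewrite leqn0 cards_eq0; apply/eqP/setP => x.
  by have := T0 x.
(* A second vertex [y] not adjacent to [x] would make [[set x; y]] a larger independent set, so [x]
   has weight 2. *)
- move/eqP/cards1P: cardA => [x Ax]; rewrite Ax big_set1 /nonneighbour_weight.
  case: ifP => // /existsP [y /andP [yx exy]].
  have /A_max : independent e [set x; y].
    by apply/independentP => u v /set2P [] -> /set2P [] ->;
      rewrite ?e_irr // e_sym.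
  rewrite Ax subsetUl => /(_ isT) /setP /(_ y).
  by rewrite !inE eqxx orbT (negPf yx).
(* In a non-adjacent pair, each vertex witnesses that the other has weight 1. *)
move/eqP/cards2P: cardA => [x [y [xy Axy]]].
have exy : ~~ e x y by apply: (independentP _ _ eA); rewrite Axy !inE eqxx ?orbT.
have weight1 u v : v != u -> ~~ e u v -> nonneighbour_weight e u = 1.
  move=> vu euv; rewrite /nonneighbour_weight ifT //.
  by apply/existsP; exists v; rewrite vu.
rewrite Axy big_setU1 ?inE //= big_set1.
by rewrite (weight1 x y) 1?eq_sym // (weight1 y x) // e_sym.
Qed.

Theorem proposition3p3 (k : fieldType) (n : nat) (e : rel 'I_n)
    (e_sym : symmetric e) (e_irr : irreflexive e) :
  independence_number e = 2 -> quasi_equigenerated (cover_ideal k e).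
Proof.
move=> e2; pose a := nonneighbour_weight e.
exists [seq set_mnm C | C <- min_covers e]; split.
  exact: cover_ideal_minimal_gens.
exists a; split=> [i|]; first by rewrite /a /nonneighbour_weight; case: ifP.
(* The common degree is the total weight minus 2, the weight of the complement of [C]; the additive
   form avoids truncated subtraction. *)
suff wdegE C : C \in min_covers e -> wdeg a (set_mnm C) + 2 = \sum_i a i.
  move=> _ _ /mapP [C /wdegE wC ->] /mapP [D /wdegE wD ->].
  by apply/eqP; rewrite -(eqn_add2r 2) wC wD.
rewrite mem_min_covers => /minsetP [C_cov C_min].
rewrite (bigID [in C]) /= /wdeg; congr (_ + _).
  rewrite [RHS]big_mkcond; apply: eq_bigr => i _; rewrite mnmE.
  by case: (i \in C); rewrite ?muln1 ?muln0.
rewrite -[LHS](max_independent_weight e_sym e_irr e2 C_cov).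
  by apply: eq_bigl => i; rewrite inE.
(* Maximality of [~: C]: the complement of a larger independent set would be a cover inside [C]. *)
move=> B eB CB; rewrite -(C_min (~: B)) ?setCK //.
  by rewrite /vertex_cover setCK.
by rewrite subCset.
Qed.
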